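(* Let $\mathcal{F}$ be a base-constrained spanning forest with linear-coupled power flow voltages as described in the context, with nodal power injections satisfying Assumption 1 of the context. If node $a \neq b$ is a descendant of node $b$ on a tree $\mathcal{T}_k$ of $\mathcal{F}$, then $\Omega_{\varepsilon}(a,a) > \Omega_{\varepsilon}(b,b)$.
   Context: Network. $\mathcal{F}$ is a finite forest, the disjoint union of $K\ge 1$ trees $\mathcal{T}_1,\dots,\mathcal{T}_K$ with undirected edge set $\mathcal{E}^{\mathcal{F}}$. Each tree $\mathcal{T}_k$ contains exactly one substation node (its slack bus, or root), and there are $N$ non-substation nodes in total, labelled $1,\dots,N$. Each edge $(ab)\in\mathcal{E}^{\mathcal{F}}$ has a resistance $r_{ab}>0$ and a reactance $x_{ab}>0$; $r^{\mathcal{F}}$ and $x^{\mathcal{F}}$ are the diagonal matrices of resistances and reactances of the edges. $M$ is the reduced directed incidence matrix: one row per (arbitrarily directed) edge $(ab)$, with entry $+1$ in column $a$ and $-1$ in column $b$, and the columns of substation nodes removed; it is square ($N\times N$) and invertible. Put $H_{1/r}=M^{T}(r^{\mathcal{F}})^{-1}M$ and $H_{1/x}=M^{T}(x^{\mathcal{F}})^{-1}M$ (reduced weighted graph Laplacians). Descendants and parents. In tree $\mathcal{T}_k$, node $b$ is a descendant of node $a$ if $a$ lies on the unique path from $b$ to the slack bus of $\mathcal{T}_k$; $D_a^{\mathcal{T}_k}$ is the set of descendants of $a$ and it includes $a$ itself. Node $b$ is the parent of $a$ if $a$ is an immediate descendant of $b$ (that is, $b$ is the neighbour of $a$ on the path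 from $a$ to the slack bus). Linear-coupled power flow (LC-PF). $p,q\in\mathbb{R}^N$ are random vectors (with finite second moments) of active and reactive power injections at the non-substation nodes. The voltage phases $\theta\in\mathbb{R}^N$ and voltage magnitude deviations $\varepsilon\in\mathbb{R}^N$ at the non-substation nodes are given by $$\theta = H_{1/x}^{-1}p - H_{1/r}^{-1}q,\qquad \varepsilon = H_{1/r}^{-1}p+H_{1/x}^{-1}q .$$ At substation nodes, $\varepsilon$ and $\theta$ have zero fluctuation (one sets $\varepsilon=\theta=0$ there). Moments. For random vectors $y,z$, $\mu_y=\mathbb{E}[y]$, $\Omega_{yz}=\mathbb{E}[(y-\mu_y)(z-\mu_z)^T]$, and $\Omega_y=\Omega_{yy}$. For a substation node $s$, $\Omega_\varepsilon(s,s)=0$. Assumption 1. For every non-substation node $a$, $\Omega_{qp}(a,a)>0$; and for all distinct non-substation nodes $a\neq b$, $\Omega_p(a,b)=\Omega_q(a,b)=\Omega_{qp}(a,b)=0$. *)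

(* Defs.v *)
From HB Require Import structures.
From mathcomp Require Import all_boot all_order all_algebra.
From mathcomp Require Import all_classical all_reals all_analysis.

Set Implicit Arguments.
Unset Strict Implicit.
Unset Printing Implicit Defensive.

Import Order.TTheory GRing.Theory Num.Theory.

Local Open Scope ring_scope.

(* [inl i] is the i-th non-substation node, [inr k] the substation (slack bus)
   of the k-th tree. *)
Definition node (N K : nat) : finType := ('I_N + 'I_K)%type.

(* The undirected graph underlying a set of arcs. *)
Definition undirected (V : finType) (E : {set V * V}) : rel V :=
  [rel u v | ((u, v) \in E) || ((v, u) \in E)].

(* The subgraph induced by [e] on [A] is a tree, for [e] symmetric and without
   loops; the length bound on cycles discards the closed walks u - v - u. *)
Definition is_tree (V : finType) (e : rel V) (A : {set V}) : Prop :=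
  [/\ A != finset.set0,
      {in A &, forall u v, connect [rel x y in A | e x y] u v} &
      forall c : seq V, {subset c <= A} -> (2 < size c)%N -> ~ ucycle e c].

(* Each undirected edge is represented by exactly one of its two directions,
   chosen arbitrarily; [arcs_asym] also excludes loops. The values of the
   impedances outside of [arcs] are irrelevant. *)
Record forest (R : realType) (N K : nat) := Forest {
  arcs : {set node N K * node N K};
  resistance : node N K * node N K -> R;
  reactance : node N K * node N K -> R;
  tree_of : node N K -> 'I_K;
  arcs_asym : forall u v, (u, v) \in arcs -> (v, u) \notin arcs;
  arcs_tree_of : forall u v, (u, v) \in arcs -> tree_of u = tree_of v;
  tree_ofP : forall k : 'I_K,
    is_tree (undirected arcs) [set u | tree_of u == k]%SET;
  tree_of_substation : forall k : 'I_K, tree_of (inr k) = k;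
  resistance_gt0 : forall e, e \in arcs -> 0 < resistance e;
  reactance_gt0 : forall e, e \in arcs -> 0 < reactance e
}.

Section Network.
Variables (R : realType) (N K : nat) (F : forest R N K).

(* The number of edges #|arcs F| equals N, but only provably so; hence the
   rectangular type. *)
Definition incidence : 'M[R]_(#|arcs F|, N) :=
  \matrix_(e, i) (((enum_val e).1 == inl i)%:R - ((enum_val e).2 == inl i)%:R).

Definition edge_diag (w : node N K * node N K -> R) : 'M[R]_#|arcs F| :=
  diag_mx (\row_e w (enum_val e)).

(* [laplacian w] is M^T W^-1 M, so the edge weights are the inverses of [w]. *)
Definition laplacian (w : node N K * node N K -> R) : 'M[R]_N :=
  incidence^T *m invmx (edge_diag w) *m incidence.

Definition H1r : 'M[R]_N := laplacian (resistance F).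
Definition H1x : 'M[R]_N := laplacian (reactance F).

(* [descendant k a b]: b is a descendant of a on the tree k. The simple path
   [b :: s] from b to the slack bus is unique since the trees are acyclic. *)
Definition descendant (k : 'I_K) (a b : node N K) : Prop :=
  exists2 s : seq (node N K),
    [/\ path (undirected (arcs F)) b s, uniq (b :: s) & last b s = inr k] &
    a \in b :: s.

Definition lc_pf (T : Type) (p q theta eps : T -> 'cV[R]_N) : Prop :=
  forall w : T,
    theta w = invmx H1x *m p w - invmx H1r *m q w /\
    eps w = invmx H1r *m p w + invmx H1x *m q w.

End Network.

Section Moments.
Context {d : measure_display} {T : measurableType d} {R : realType}.
Variable P : probability T R.

Definition finite_second_moments (N : nat) (y : T -> 'cV[R]_N) : Prop :=
  forall i, (fun w => y w i 0) \in Lfun P 2.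

Definition Omega (I : Type) (y z : T -> I -> R) (a b : I) : \bar R :=
  covariance P (fun w => y w a) (fun w => z w b).

Definition entries (N : nat) (y : T -> 'cV[R]_N) (w : T) (i : 'I_N) : R :=
  y w i 0.

(* The value at every node of a quantity that vanishes at the substations. *)
Definition nodal (N K : nat) (y : T -> 'cV[R]_N) (w : T) (u : node N K) : R :=
  match u with inl i => y w i 0 | inr _ => 0 end.

Definition assumption1 (N : nat) (p q : T -> 'cV[R]_N) : Prop :=
  (forall a, (0 < Omega (entries q) (entries p) a a)%E) /\
  (forall a b, a != b ->
     [/\ Omega (entries p) (entries p) a b = 0%E,
         Omega (entries q) (entries q) a b = 0%E &
         Omega (entries q) (entries p) a b = 0%E]).

End Moments.

(* Main.v *)
Require Import Defs.
From HB Require Import structures.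
From mathcomp Require Import all_boot all_order all_algebra.
From mathcomp Require Import all_classical all_reals all_analysis.

Set Implicit Arguments.
Unset Strict Implicit.
Unset Printing Implicit Defensive.

Import Order.TTheory GRing.Theory Num.Theory.

Local Open Scope ring_scope.

(** Column [c] of an inverse reduced Laplacian is the electric potential created
    in the network by a unit current injected at [c] and withdrawn at the
    substations, which are grounded. Removing an edge x - y of a forest, with y
    on the path from x to the substation, separates the side D of x, which
    contains no substation, from y. Conservation of charge on D says that the
    whole current injected in D flows out through that edge, so by Ohm's law
      potential x - potential y = impedance * (current injected in D)
    ([edge_drop]). Hence a potential without injection vanishes, which makes
    the Laplacian invertible ([laplacian_unit]); and the potential of a unit
    injection at c does not increase on the way to the substation, is
    nonnegative, and strictly decreases along the first edge when the path
    starts at c ([green_path]).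

    For the variances, let G_r and G_x be the two inverse Laplacians, extended
    by 0 at the substations. Injections at distinct nodes are uncorrelated, so
      Var eps_u = sum over c of Var (G_r(u,c) p_c + G_x(u,c) q_c)
    ([variance_voltage]), and since p_c and q_c are positively correlated each
    summand is monotone in the nonnegative coefficients G_r(u,c) and G_x(u,c),
    strictly if both of them increase ([variance_comb_le],
    [variance_comb_lt]). When a is a proper descendant of b, all coefficients
    at a dominate those at b, and both are strictly larger for c = a. *)

(** * Edges of a forest and the two sides of an edge *)

Lemma undirected_sym (V : finType) (E : {set V * V}) :
  symmetric (undirected E).
Proof. by move=> u v; rewrite /undirected /= orbC. Qed.

Definition cut_edge (V : finType) (e : rel V) (x y : V) : rel V :=
  [rel u v | e u v && ((u, v) \notin [:: (x, y); (y, x)])].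

Lemma cut_edge_sym (V : finType) (e : rel V) (x y : V) :
  symmetric e -> symmetric (cut_edge e x y).
Proof.
move=> e_sym u v; rewrite /cut_edge /= e_sym !inE !xpair_eqE; congr (_ && ~~ _).
by rewrite orbC andbC [(u == x) && _]andbC.
Qed.

Section Forest.
Variables (R : realType) (N K : nat) (F : forest R N K).

Let e := undirected (arcs F).

Lemma edge_neq u v : e u v -> u != v.
Proof.
apply: contraTneq => ->; rewrite /e /undirected /= orbb.
by apply/negP => vv; have := arcs_asym vv; rewrite vv.
Qed.

Lemma edge_tree_of u v : e u v -> Defs.tree_of F u = Defs.tree_of F v.
Proof. by case/orP => /arcs_tree_of. Qed.

Lemma path_tree_of x s z : path e x s -> z \in x :: s ->
  Defs.tree_of F z = Defs.tree_of F x.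
Proof.
elim: s x => [|y s IHs] x /=; first by move=> _; rewrite inE => /eqP ->.
move=> /andP[/edge_tree_of xy ys]; rewrite inE => /predU1P[-> //|zs].
by rewrite xy; exact: IHs.
Qed.

(** Otherwise a simple path from x to y that avoids the edge, closed up by this
    very edge, would be a cycle of length at least 3. *)
Lemma bridge x y : e x y -> ~~ connect (cut_edge e x y) x y.
Proof.
move=> exy; apply/negP => /connectP[s0 xs0 yE].
move: yE; case/shortenP: xs0 => s xs uniq_s _ yE.
have es : path e x s by apply: sub_path xs => u v /andP[].
have [_ _ acyclic] := tree_ofP F (Defs.tree_of F x).
apply: (acyclic (x :: s)).
- by move=> z zs; rewrite inE (path_tree_of es zs).
- case: s xs yE {uniq_s es} => [_ xy|z [|//]].
    by move: (edge_neq exy); rewrite xy eqxx.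
  (* The path x - z with z = y would use the removed edge. *)
  by move=> /= /andP[/andP[_]] + _ zy; rewrite zy mem_head.
- rewrite /ucycle uniq_s /= rcons_path es -yE andbT /=.
  by rewrite undirected_sym.
Qed.

Definition side x y : {set node N K} :=
  [set z | connect (cut_edge e x y) x z]%SET.

Lemma side_cut_edge x y u v : cut_edge e x y u v ->
  (u \in side x y) = (v \in side x y).
Proof.
move=> cuv; rewrite !inE; apply: same_connect_r; last exact: connect1.
exact/sym_connect_sym/cut_edge_sym/undirected_sym.
Qed.

(** The rest of the path joins y to the substation of the tree without meeting
    x, hence without using the edge x - y; so if that substation were on the
    side of x then y would be too, against [bridge]. The other substations are
    in other trees. *)
Lemma substation_notin_side k x y s l :
    path e x (y :: s) -> uniq [:: x, y & s] -> last y s = inr k ->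
  inr l \notin side x y.
Proof.
move=> exys /= /andP[x_notin _] last_s; have [exy es] := andP exys.
have [->|kl] := eqVneq l k; last first.
  apply: contra kl; rewrite inE => /connectP[t ct lastE].
  have et : path e x t by apply: sub_path ct => u v /andP[].
  have := path_tree_of et (mem_last x t).
  rewrite -lastE tree_of_substation => ->.
  have := path_tree_of exys (mem_last x (y :: s)).
  by rewrite /= last_s tree_of_substation => ->.
apply: contra (bridge exy); rewrite -last_s inE => /connect_trans; apply.
rewrite sym_connect_sym; last exact/cut_edge_sym/undirected_sym.
apply/connectP; exists s => //.
have avoid_x : all (predC1 x) (y :: s).
  by apply/allP => z zs; apply: contraNneq x_notin => <-.
apply: sub_in_path avoid_x es => u v ux vx euv.
rewrite /cut_edge /= euv !inE !xpair_eqE.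
by rewrite (negPf (ux : u != x)) (negPf (vx : v != x)) andbF.
Qed.

Lemma root_path u : exists s k,
  [/\ path e u s, uniq (u :: s) & last u s = inr k].
Proof.
have [_ conn _] := tree_ofP F (Defs.tree_of F u).
have := conn u (inr (Defs.tree_of F u)).
rewrite !inE tree_of_substation => /(_ (eqxx _) (eqxx _)).
move=> /connectP[s0 us0 lastE].
move: lastE; case/shortenP: us0 => s us uniq_s _ lastE.
exists s, (Defs.tree_of F u); split=> //.
by apply: sub_path us => a b /=; rewrite !inE => /andP[_].
Qed.

(** * Potentials and currents *)

(** The substations are grounded: their columns are absent from the incidence
    matrix, which amounts to the value 0 there. *)
Definition potential (v : 'cV[R]_N) (u : node N K) : R :=
  if u is inl i then v i 0 else 0.

Lemma mul_incidence (v : 'cV[R]_N) j :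
  (incidence F *m v) j 0 =
  potential v (enum_val j).1 - potential v (enum_val j).2.
Proof.
have sum_delta u : \sum_i (u == inl i)%:R * v i 0 = potential v u.
  case: u => [i|k] /=; last by rewrite big1 // => i _; rewrite mul0r.
  rewrite (bigD1 i) //= eqxx mul1r big1 ?addr0 // => l li.
  by rewrite (inj_eq inl_inj) eq_sym (negPf li) mul0r.
rewrite mxE -!sum_delta -sumrB; apply: eq_bigr => i _.
by rewrite mxE mulrBl.
Qed.

Section Weight.
Variables (w : node N K * node N K -> R)
  (w_gt0 : forall a, a \in arcs F -> 0 < w a).

Lemma edge_diagV (f : 'cV[R]_#|arcs F|) i :
  (invmx (edge_diag F w) *m f) i 0 = f i 0 / w (enum_val i).
Proof.
have w_neq0 (j : 'I_#|arcs F|) : w (enum_val j) != 0.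
  by apply/lt0r_neq0/w_gt0/enum_valP.
have W_unit : edge_diag F w \in unitmx.
  by rewrite unitmxE det_diag unitfE; apply/prodf_neq0 => j _; rewrite mxE.
have {2}-> : f = edge_diag F w *m (invmx (edge_diag F w) *m f).
  by rewrite mulKVmx.
by rewrite mul_diag_mx !mxE mulrC mulKf.
Qed.

(** Summation by parts: the incidence matrix is a discrete gradient, and
    multiplying by its transpose is minus the divergence. *)
Lemma dirichlet_form (f v : 'cV[R]_N) :
  \sum_i f i 0 * (laplacian F w *m v) i 0 =
  \sum_(a in arcs F) (potential f a.1 - potential f a.2) *
    ((potential v a.1 - potential v a.2) / w a).
Proof.
rewrite [RHS]big_enum_val /=.
transitivity ((f^T *m (laplacian F w *m v)) 0 0).
  by rewrite [RHS]mxE; apply: eq_bigr => i _; rewrite [f^T _ _]mxE.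
rewrite /laplacian -!mulmxA mulmxA -trmx_mul mxE /=; apply: eq_bigr => j _.
by rewrite [_^T _ _]mxE edge_diagV !mul_incidence.
Qed.

(** Conservation of charge, by pairing with the indicator function of [D] in
    the Dirichlet form; [D] must avoid the substations because
    the reduced Laplacian has no balance equation there. *)
Lemma outflow (D : {set node N K}) (v : 'cV[R]_N) :
    (forall l, inr l \notin D) ->
  \sum_(i | inl i \in D) (laplacian F w *m v) i 0 =
  \sum_(a in arcs F) ((a.1 \in D)%:R - (a.2 \in D)%:R) *
    ((potential v a.1 - potential v a.2) / w a).
Proof.
move=> D_grounded; pose f : 'cV[R]_N := \col_i (inl i \in D)%:R.
have fE u : potential f u = (u \in D)%:R.
  by case: u => [i|l]; rewrite /= ?mxE // (negPf (D_grounded l)).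
rewrite big_mkcond /=; under [RHS]eq_bigr do rewrite -!fE.
rewrite -dirichlet_form; apply: eq_bigr => i _; rewrite [f _ _]mxE.
by case: ifP; rewrite ?mul1r ?mul0r.
Qed.

(** The edge x - y is the only one that leaves the side of x, so the current
    through it is the total injection on that side. The same [D] serves for all
    [v]: membership in it does not depend on the injections. *)
Lemma edge_drop k x y s : path e x (y :: s) -> uniq [:: x, y & s] ->
    last y s = inr k ->
  exists i r (D : {set node N K}), [/\ x = inl i, inl i \in D, 0 < r &
    forall v : 'cV[R]_N, potential v x - potential v y =
      r * \sum_(j | inl j \in D) (laplacian F w *m v) j 0].
Proof.
move=> exys uniq_s last_s; have [exy _] := andP exys.
pose D := side x y.
have xD : x \in D by rewrite inE connect0.
have yD : y \notin D by rewrite inE bridge.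
have rootD l : inr l \notin D := substation_notin_side l exys uniq_s last_s.
have only_xy a : a \in arcs F -> a \notin [:: (x, y); (y, x)] ->
    (a.1 \in D) = (a.2 \in D).
  case: a => u v uv cut; apply: side_cut_edge; apply/andP; split=> //=.
  by rewrite /e /undirected /= uv.
have [i xE] : exists i, x = inl i.
  by case: (x) xD => [i|l]; [exists i | rewrite (negPf (rootD l))].
have iD : inl i \in D by rewrite -xE.
have [xy|xy] := boolP ((x, y) \in arcs F).
  exists i, (w (x, y)), D; split=> // [|v]; first exact: w_gt0.
  rewrite outflow // (bigD1 (x, y)) //= xD (negPf yD).
  rewrite big1 => [|a /andP[aF a_xy]].
    by rewrite addr0 subr0 mul1r mulrC divfK // gt_eqF // w_gt0.
  rewrite only_xy ?subrr ?mul0r // !inE negb_or a_xy /=.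
  by apply: contraTneq aF => ->; apply: arcs_asym.
have yx : (y, x) \in arcs F by move: exy; rewrite /e /undirected /= (negPf xy).
exists i, (w (y, x)), D; split=> // [|v]; first exact: w_gt0.
rewrite outflow // (bigD1 (y, x)) //= xD (negPf yD).
rewrite big1 => [|a /andP[aF a_yx]].
  by rewrite addr0 sub0r mulN1r -mulNr opprB mulrC divfK // gt_eqF // w_gt0.
rewrite only_xy ?subrr ?mul0r // !inE negb_or a_yx andbT.
by apply: contraNneq xy => <-.
Qed.

(** Without injections no edge carries a current, so a potential in the kernel
    is constant along the path from each node to a substation, where it is 0. *)
Lemma laplacian_unit : laplacian F w \in unitmx.
Proof.
rewrite -unitmx_tr -row_free_unit; apply: inj_row_free => u uH0.
have Hv0 : laplacian F w *m u^T = 0.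
  by rewrite -[LHS]trmxK trmx_mul trmxK uH0 trmx0.
suff pot0 x : potential u^T x = 0.
  by apply/rowP => i; have := pot0 (inl i); rewrite /= !mxE.
have [s [k [xs uniq_s last_s]]] := root_path x.
elim: s x xs uniq_s last_s => [|y s IHs] x xs uniq_s last_s.
  by rewrite (last_s : x = _).
have [_ [r [D [_ _ _ drop]]]] := edge_drop xs uniq_s last_s.
move: xs uniq_s => /= /andP[_ ys] /andP[_ uniq_s].
have := drop u^T; rewrite (IHs y) // subr0 Hv0 => ->.
by rewrite big1 ?mulr0 // => i _; rewrite mxE.
Qed.

(** The discrete Green function: the potential of a unit injection at [c]. *)
Definition green (c : 'I_N) : 'cV[R]_N := col c (invmx (laplacian F w)).

Lemma laplacian_green c j : (laplacian F w *m green c) j 0 = (j == c)%:R.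
Proof. by rewrite /green colE mulmxA mulmxV ?laplacian_unit // -colE !mxE. Qed.

(** The drop along an edge is its impedance if [c] is behind it, else 0. *)
Lemma green_edge c k x y s : path e x (y :: s) -> uniq [:: x, y & s] ->
    last y s = inr k ->
  potential (green c) y <= potential (green c) x /\
  (x = inl c -> potential (green c) y < potential (green c) x).
Proof.
move=> xs uniq_s last_s.
have [i [r [D [-> iD r_gt0 drop]]]] := edge_drop xs uniq_s last_s.
have {}drop : potential (green c) (inl i) - potential (green c) y =
    r * (inl c \in D)%:R.
  rewrite drop; congr (_ * _); under eq_bigr do rewrite laplacian_green.
  rewrite big_mkcond (bigD1 c) //= eqxx big1 ?addr0; last first.
    by move=> j /negPf ->; rewrite if_same.
  by case: ifP.
split; first by rewrite -subr_ge0 drop mulr_ge0 ?ler0n // ltW.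
by move=> [ic]; rewrite -subr_gt0 drop -ic iD mulr1.
Qed.

(** Iterating [green_edge] along the path; nonnegativity comes from comparing
    with the substation at the end, where the potential is 0. *)
Lemma green_path c k x s y : path e x s -> uniq (x :: s) -> last x s = inr k ->
    y \in s ->
  [/\ 0 <= potential (green c) y,
      potential (green c) y <= potential (green c) x &
      x = inl c -> potential (green c) y < potential (green c) x].
Proof.
elim: s x y => // z s IHs x y xs uniq_s last_s ys.
have [le_zx lt_zx] := green_edge c xs uniq_s last_s.
move: xs uniq_s => /= /andP[_ zs] /andP[_ uniq_s].
have [ge0 le_yz] : 0 <= potential (green c) y /\
    potential (green c) y <= potential (green c) z.
  move: ys; rewrite inE => /predU1P[->|ys].
    2: by case: (IHs z y zs uniq_s last_s ys).
  split=> //.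
  have [s0|last_in] : s = [::] \/ last z s \in s.
  - by case: (s) => [|t s']; [left | right; exact: (mem_last t s')].
  - by move: last_s; rewrite s0 /= => ->.
  - have [ge0 le_z _] := IHs z _ zs uniq_s last_s last_in.
    exact: le_trans ge0 le_z.
split=> //; first exact: le_trans le_yz le_zx.
by move=> /lt_zx; apply: le_lt_trans.
Qed.

Lemma mulmx_green (y : 'cV[R]_N) u :
  potential (invmx (laplacian F w) *m y) u =
  \sum_c potential (green c) u * y c 0.
Proof.
case: u => [i|l] /=; last by rewrite big1 // => c _; rewrite mul0r.
by rewrite mxE; apply: eq_bigr => c _; rewrite mxE.
Qed.

End Weight.
End Forest.

(** * Variances of linear combinations *)

Section Moments.
Context d (T : measurableType d) (R : realType) (P : probability T R).

Lemma Lfun2_scale a (X : T -> R) :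
    X \in Lfun P 2%:E -> a \o* X \in Lfun P 2%:E.
Proof. by apply: Lfun_scale; rewrite ler1n. Qed.

Lemma Lfun2_comb a b (X Y : T -> R) :
    X \in Lfun P 2%:E -> Y \in Lfun P 2%:E ->
  a \o* X \+ b \o* Y \in Lfun P 2%:E.
Proof.
move=> X2 Y2.
by apply: (rpredD (Lfun2_scale a X2) (Lfun2_scale b Y2)); rewrite lee1n.
Qed.

Lemma Lfun2_sum (I : Type) (s : seq I) (X : I -> T -> R) :
    (forall i, X i \in Lfun P 2%:E) ->
  (fun t => \sum_(i <- s) X i t) \in Lfun P 2%:E.
Proof.
move=> X2; elim: s => [|i s IHs].
  by under eq_fun do rewrite big_nil; exact: Lfun_cst.
under eq_fun do rewrite big_cons.
by apply: (rpredD (X2 i) IHs); rewrite lee1n.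
Qed.

Lemma covariance_suml (I : Type) (s : seq I) (X : I -> T -> R) (Z : T -> R) :
    (forall i, X i \in Lfun P 2%:E) -> Z \in Lfun P 2%:E ->
  covariance P (fun t => \sum_(i <- s) X i t) Z =
  (\sum_(i <- s) covariance P (X i) Z)%E.
Proof.
move=> X2 Z2; elim: s => [|i s IHs].
  by rewrite big_nil; under eq_fun do rewrite big_nil; exact: covariance_cst_l.
rewrite big_cons -IHs -covarianceDl //; last exact: Lfun2_sum.
by congr covariance; apply/funext => t; rewrite big_cons.
Qed.

Lemma variance_sum_uncorrelated (I : finType) (X : I -> T -> R) :
    (forall i, X i \in Lfun P 2%:E) ->
    (forall i j, i != j -> covariance P (X i) (X j) = 0%E) ->
  variance P (fun t => \sum_i X i t) = (\sum_i variance P (X i))%E.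
Proof.
move=> X2 X_uncor; rewrite /variance covariance_suml //; last exact: Lfun2_sum.
apply: eq_bigr => i _.
rewrite covarianceC covariance_suml // (bigD1 i) //= big1 ?adde0 // => j ji.
exact: X_uncor.
Qed.

Lemma covariance_scale a b (X Y : T -> R) :
    X \in Lfun P 2%:E -> Y \in Lfun P 2%:E ->
  covariance P (a \o* X) (b \o* Y) = ((a * b)%:E * covariance P X Y)%E.
Proof.
move=> X2 Y2; have Pfin := fin_num_measure P _ measurableT.
have L1 (Z : T -> R) : Z \in Lfun P 2%:E -> Z \in Lfun P 1.
  exact: Lfun_subset12.
have bY2 := Lfun2_scale b Y2.
rewrite covarianceZl ?covarianceZr ?EFinM ?muleA //;
  by [exact: L1 | exact: Lfun2_mul_Lfun1].
Qed.

Lemma variance_comb a b (X Y : T -> R) :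
    X \in Lfun P 2%:E -> Y \in Lfun P 2%:E ->
  variance P (a \o* X \+ b \o* Y) =
  ((a ^+ 2)%:E * variance P X + (b ^+ 2)%:E * variance P Y +
   (2 * (a * b))%:E * covariance P X Y)%E.
Proof.
move=> X2 Y2; rewrite varianceD ?Lfun2_scale // !varianceZ //.
by rewrite covariance_scale // EFinM muleA.
Qed.

Lemma covariance_comb0 a b a' b' (X Y X' Y' : T -> R) :
    X \in Lfun P 2%:E -> Y \in Lfun P 2%:E ->
    X' \in Lfun P 2%:E -> Y' \in Lfun P 2%:E ->
    covariance P X X' = 0%E -> covariance P X Y' = 0%E ->
    covariance P Y X' = 0%E -> covariance P Y Y' = 0%E ->
  covariance P (a \o* X \+ b \o* Y) (a' \o* X' \+ b' \o* Y') = 0%E.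
Proof.
move=> X2 Y2 X'2 Y'2 XX' XY' YX' YY'.
have XY'2 := Lfun2_comb a' b' X'2 Y'2.
rewrite covarianceDl ?Lfun2_scale // !covarianceDr ?Lfun2_scale //.
by rewrite !covariance_scale // XX' XY' YX' YY' !mule0 !adde0.
Qed.

(** All three coefficients in [variance_comb] are monotone in nonnegative [a]
    and [b], and they multiply nonnegative moments. *)
Lemma variance_comb_le a b a' b' (X Y : T -> R) :
    X \in Lfun P 2%:E -> Y \in Lfun P 2%:E -> (0 <= covariance P X Y)%E ->
    0 <= a <= a' -> 0 <= b <= b' ->
  (variance P (a \o* X \+ b \o* Y)%R <= variance P (a' \o* X \+ b' \o* Y)%R)%E.
Proof.
move=> X2 Y2 XY_ge0 /andP[a_ge0 aa'] /andP[b_ge0 bb'].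
rewrite !variance_comb //; apply: leeD; first apply: leeD.
- rewrite lee_wpmul2r ?variance_ge0 // lee_fin.
  by rewrite lerXn2r // nnegrE (le_trans a_ge0).
- rewrite lee_wpmul2r ?variance_ge0 // lee_fin.
  by rewrite lerXn2r // nnegrE (le_trans b_ge0).
- by rewrite lee_wpmul2r // lee_fin ler_wpM2l ?ler0n // ler_pM.
Qed.

(** The strict inequality comes from the covariance term alone: the variances of
    [X] and [Y] enter through weak inequalities only. *)
Lemma variance_comb_lt a b a' b' (X Y : T -> R) :
    X \in Lfun P 2%:E -> Y \in Lfun P 2%:E -> (0 < covariance P X Y)%E ->
    0 <= a < a' -> 0 <= b < b' ->
  (variance P (a \o* X \+ b \o* Y)%R < variance P (a' \o* X \+ b' \o* Y)%R)%E.
Proof.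
move=> X2 Y2 XY_gt0 /andP[a_ge0 aa'] /andP[b_ge0 bb'].
have Pfin := fin_num_measure P _ measurableT.
have XY_fin : covariance P X Y \is a fin_num.
  by apply: covariance_fin_num; [exact: Lfun_subset12 | exact: Lfun_subset12 |
    exact: Lfun2_mul_Lfun1].
rewrite !variance_comb //; apply: lee_ltD.
- by rewrite fin_numD !fin_numM // variance_fin_num.
- apply: leeD; rewrite lee_wpmul2r ?variance_ge0 // lee_fin lerXn2r //
    ?nnegrE ?ltW //; exact: le_lt_trans aa' || exact: le_lt_trans bb'.
- by rewrite lte_pmul2r // lte_fin ltr_pM2l ?ltr0n // ltr_pM.
Qed.

End Moments.

(** * Voltage variances *)

Section Voltages.
Context (R : realType) (N K : nat) (F : forest R N K)
  (d : measure_display) (T : measurableType d) (P : probability T R)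
  (p q theta eps : T -> 'cV[R]_N).
Hypotheses (p_L2 : finite_second_moments P p)
  (q_L2 : finite_second_moments P q)
  (hpf : lc_pf F p q theta eps) (h1 : assumption1 P p q).

(** The active and the reactive injection at the same node may be correlated,
    so they are kept together in one summand. *)
Lemma variance_voltage (u : node N K) :
  Omega P (nodal eps) (nodal eps) u u =
  (\sum_c variance P
     (potential (green F (resistance F) c) u \o* (fun t => p t c 0%R) \+
      potential (green F (reactance F) c) u \o* (fun t => q t c 0%R))%R)%E.
Proof.
rewrite -variance_sum_uncorrelated.
- congr (variance P _); apply/funext => t.
  have -> : nodal eps t u = potential (eps t) u by case: u.
  have [_ ->] := hpf t.
  have -> (y z : 'cV[R]_N) :
      potential (y + z) u = potential y u + potential z u.
    by case: u => [i|l] /=; rewrite ?mxE ?addr0.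
  rewrite !mulmx_green -big_split; apply: eq_bigr => c _ /=.
  by rewrite [X in X + _]mulrC [X in _ + X]mulrC.
- by move=> c; apply: Lfun2_comb.
- move=> c c' cc'; have [_ uncor] := h1.
  have [pp qq qp] := uncor _ _ cc'.
  have /uncor [_ _ qp'] : c' != c by rewrite eq_sym.
  apply: covariance_comb0 => //.
  rewrite covarianceC; exact: qp'.
Qed.

End Voltages.

Theorem theorem1 (R : realType) (N K : nat) (hK : (0 < K)%N)
  (F : forest R N K)
  (d : measure_display) (T : measurableType d) (P : probability T R)
  (p q theta eps : T -> 'cV[R]_N)
  (p_L2 : finite_second_moments P p) (q_L2 : finite_second_moments P q)
  (hpf : lc_pf F p q theta eps)
  (h1 : assumption1 P p q)
  (k : 'I_K) (a b : node N K) :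
  a != b -> descendant F k b a ->
  (Omega P (nodal eps) (nodal eps) b b < Omega P (nodal eps) (nodal eps) a a)%E.
Proof.
move=> a_neq_b [s [as_path uniq_s last_s]].
rewrite inE eq_sym (negPf a_neq_b) /= => b_in_s.
have r_gt0 := @resistance_gt0 _ _ _ F; have x_gt0 := @reactance_gt0 _ _ _ F.
(* A substation is not the start of a nontrivial path to the slack bus. *)
have [i aE] : exists i, a = inl i.
  case: s as_path uniq_s last_s b_in_s => // y s ap us ls _.
  by have [i [_ [_ [-> _ _ _]]]] := edge_drop r_gt0 ap us ls; exists i.
have green_r c := green_path r_gt0 c as_path uniq_s last_s b_in_s.
have green_x c := green_path x_gt0 c as_path uniq_s last_s b_in_s.
have qp_gt0 c : (0 < covariance P (fun t => p t c 0%R) (fun t => q t c 0%R))%E.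
  by rewrite covarianceC; apply: (h1.1 c).
rewrite !(variance_voltage p_L2 q_L2 hpf h1).
rewrite (bigD1 i) //= [ltRHS](bigD1 i) //=; apply: lte_leD.
- by apply/sum_fin_numP => c _ _; apply/variance_fin_num/Lfun2_comb.
- have [r0 _ r_lt] := green_r i; have [x0 _ x_lt] := green_x i.
  by apply: variance_comb_lt; rewrite ?r0 ?x0 ?r_lt ?x_lt.
- apply: lee_sum => c _.
  have [r0 r_le _] := green_r c; have [x0 x_le _] := green_x c.
  by apply: variance_comb_le; rewrite ?r0 ?x0 //; apply: ltW.
Qed.
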